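(* For all positive integers $n,k$, $$ p_{k}(n)=\frac{1}{n!}\sum_{l=0}^{n}(-1)^{l}\,(k)^{(l)}\,B_{n,l}(\lambda_{1},\lambda_{2},\ldots,\lambda_{n-l+1}), $$ where $p_k(n)$ is the number of $k$-coloured partitions of $n$, $B_{n,l}$ is the partial Bell polynomial, $(k)^{(l)}=k(k+1)\cdots(k+l-1)$ is the rising factorial, and for $i\ge 1$ $$ \lambda_{i}= \begin{cases} (-1)^{m}\, i! & \text{if } i=\frac{m(3m+1)}{2} \text{ for some positive integer } m,\\ (-1)^{m}\, i! & \text{if } i=\frac{m(3m-1)}{2} \text{ for some positive integer } m,\\ 0 & \text{otherwise.} \end{cases} $$
   Context: A partition of a positive integer $n$ is a finite weakly decreasing sequence of positive integers (its parts) with sum $n$. A partition is $k$-coloured if each part can occur in $k$ colours; $p_k(n)$ denotes the number of $k$-coloured partitions of $n$, i.e. the number of finite multisets of pairs $(\lambda,c)$, with $\lambda$ a positive integer and $c\in\{1,\ldots,k\}$ a colour, such that the sum of the first entries (counted with multiplicity) is $n$. For example, $p_2(2)=5$, the $2$-coloured partitions of $2$ being $1+1,\ 1'+1,\ 1'+1',\ 2,\ 2'$. For non-negative integers $n,l$, the partial Bell polynomial is $$ B_{n,l}(x_1,\ldots,x_{n-l+1})=\sum \frac{n!}{\prod_{i=1}^{n-l+1}\ell_i!}\prod_{i=1}^{n-l+1}\Bigl(\frac{x_i}{i!}\Bigr)^{\ell_i}, $$ the sum running over all sequences of non-negative integers $\ell_i$ with $\sum_i i\,\ell_i=n$ and $\sum_i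 \ell_i=l$. In particular $B_{0,0}=1$, $B_{n,0}=0$ for $n\ge1$, and $B_{0,l}=0$ for $l\ge 1$. The rising factorial satisfies $(k)^{(0)}=1$ (empty product). *)

(* Defs.v *)
From mathcomp Require Import all_boot all_order all_algebra.
From mathcomp Require Import finmap multiset.
From mathcomp Require Import boolp classical_sets functions cardinality.

Set Implicit Arguments.
Unset Strict Implicit.
Unset Printing Implicit Defensive.

Local Open Scope mset_scope.
Local Open Scope classical_set_scope.

(* A coloured part is a pair (part, colour), the colours being 0, ..., k-1.
   [all] and [\sum] range over [A] with multiplicity. *)
Definition coloured_partition (k n : nat) (A : {mset nat * 'I_k}) : bool :=
  all (fun x => 0 < x.1) A && (\sum_(x <- A) x.1 == n).

(* [fset_set] is meaningful here thanks to [finite_coloured_partitions]. *)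
Definition ncoloured_partitions (k n : nat) : nat :=
  #|` fset_set [set A : {mset nat * 'I_k} | coloured_partition n A] |.

Lemma finite_coloured_partitions (k n : nat) :
  finite_set [set A : {mset nat * 'I_k} | coloured_partition n A].
Proof.
pose T := {m : 'I_n.+1 & m.-tuple ('I_n.+1 * 'I_k)}.
pose h (t : T) : {mset nat * 'I_k} :=
  seq_mset [seq (val p.1, p.2) | p <- tval (tagged t)].
apply: (@sub_finite_set _ _ (h @` setT)); last first.
  by apply: finite_image; exact: finite_finset.
move=> A /= /andP[/allP A0 /eqP An].
have le_part x : x \in A -> x.1 < n.+1.
  move=> xA; rewrite ltnS -An (big_rem x) //=; exact: leq_addr.
have size_le : size A < n.+1.
  rewrite ltnS -An -sum1_size big_seq [leqRHS]big_seq.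
  by apply: leq_sum => x /A0.
pose s : seq ('I_n.+1 * 'I_k) := [seq (inord x.1, x.2) | x <- A].
have sP : size s == Ordinal size_le by rewrite size_map.
exists (Tagged (fun m : 'I_n.+1 => m.-tuple _) (Tuple sP)) => //.
rewrite /h /= /s -map_comp -[RHS]seq_mset_id; congr seq_mset.
rewrite -[RHS]map_id; apply/eq_in_map => -[i c] /le_part /= lti.
by rewrite inordK.
Qed.

Import GRing.Theory.
Local Open Scope ring_scope.

(* [e i : 'I_n.+1] is the exponent attached to the variable [x i.+1]; bounding
   the exponents by n loses nothing since [\sum_i i.+1 * e i = n].  For l > n
   the truncated [n - l] leaves the single variable [x 1], and the sum is empty. *)
Definition partial_bell (n l : nat) (x : nat -> rat) : rat :=
  \sum_(e : {ffun 'I_(n - l + 1) -> 'I_n.+1} |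
         (\sum_(i < n - l + 1) i.+1 * e i == n)%N &&
         (\sum_(i < n - l + 1) e i == l)%N)
    (n`!)%:R / (\prod_(i < n - l + 1) (e i)`!)%:R *
      \prod_(i < n - l + 1) (x i.+1 / (i.+1)`!%:R) ^+ e i.

Definition rising_factorial (k l : nat) : nat := (\prod_(j < l) (k + j))%N.

(* The halvings are exact, and such an m is at most i.  No i is of both forms. *)
Definition pentagonal_coef (i : nat) : rat :=
  if [pick m : 'I_i.+1 | (0 < m)%N && (i == (m * (3 * m + 1)) %/ 2)%N] is Some m
  then (-1) ^+ m * (i`!)%:R
  else if [pick m : 'I_i.+1 | (0 < m)%N && (i == (m * (3 * m - 1)) %/ 2)%N]
       is Some m
  then (-1) ^+ m * (i`!)%:R
  else 0.

(* Main.v *)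
Require Import Defs.
From mathcomp Require Import all_boot all_order all_algebra.
From mathcomp Require Import finmap multiset.
From mathcomp Require Import classical_sets cardinality.
From mathcomp Require Import ring zify.

(** The generating function of the k-coloured partitions is
    [\prod_(i >= 1) (1 - X^i)^-k].  By Euler's pentagonal number theorem,
    [\prod_(i >= 1) (1 - X^i) = 1 + u], where [u] is the exponential generating
    function of the coefficients lambda_i ([pentagonal_coef]).  Hence the
    generating function is [(1 + u)^-k], which the binomial series expands as
    [\sum_l (-1)^l k^(l) / l! u^l], and the coefficient of [X^n] in [u^l / l!]
    is [B_{n,l}(lambda) / n!], because the multinomial theorem turns [u^l] into
    the sum over exponent vectors that defines the Bell polynomial.

    Only the coefficients up to degree [n] matter, so everything takes place in
    [{poly rat}] modulo [X^(n+1)], the congruence of [p] and [q] being written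
    [X^(n+1) %| p - q].  The inverses become polynomials [G] and [F] such that
    [(\prod_i (1 - X^i))^k * G] and [(1 + u)^k * F] are both congruent to 1; as
    inverses are unique modulo [X^(n+1)], the coefficients of [X^n] in [G] and
    in [F] agree.  These coefficients are the two sides of the theorem.

    The ingredients are
    - [coloured_generating], which reads the number of coloured partitions off
      a product of truncated geometric series;
    - [euler_pentagonal], the pentagonal number theorem modulo [X^(n+1)],
      deduced from the finite identity [shanks_identity];
    - [partial_bellE], the Bell polynomial as a coefficient of [u^l];
    - [binomial_series_inverse], the expansion of [(1 + u)^-k]. *)

Set Implicit Arguments.
Unset Strict Implicit.
Unset Printing Implicit Defensive.

Import GRing.Theory Num.Theory.
Local Open Scope ring_scope.

(** * Congruences modulo a power of X *)

Lemma dvdXnP (F : fieldType) (m : nat) (p : {poly F}) :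
  reflect (forall i, (i < m)%N -> p`_i = 0) ('X^m %| p).
Proof.
apply: (iffP (dvdpP _ _)) => [[q ->] i ltim|p0]; first by rewrite coefMXn ltim.
exists (drop_poly m p); rewrite -[LHS](poly_take_drop m).
rewrite (_ : take_poly m p = 0) ?add0r //; apply/polyP => i.
by rewrite coef_take_poly coef0; case: ifP => // /p0.
Qed.

Lemma coef_signM (R : comNzRingType) s (p : {poly R}) i :
  ((-1) ^+ s * p)`_i = (-1) ^+ s * p`_i.
Proof. by rewrite -coefCM rmorphXn rmorphN1. Qed.

Lemma factq_neq0 n : (n`!)%:R != 0 :> rat.
Proof. by rewrite pnatr_eq0 -lt0n fact_gt0. Qed.

(** * Euler's pentagonal number theorem *)

(** Generalized pentagonal numbers, [m(3m-1)/2] and [m(3m+1)/2]; in this form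
    they are the exponents that Shanks's identity produces, and no division is
    involved. *)
Definition pentagonal_minus (m : nat) : nat := m * m + 'C(m, 2).
Definition pentagonal_plus (m : nat) : nat := m * m + 'C(m.+1, 2).

(** Shanks's finite form of the pentagonal number theorem.  Going from [n] to
    [n + 1] changes the s-th summand [A s] of the left-hand side by a difference
    [T s - T (s + 1)], so the change of the sum telescopes to its boundary term
    [- T (n + 1)]; together with the new summand [s = n + 1] this is exactly the
    new summand of the right-hand side. *)
Lemma shanks_identity (R : comNzRingType) (x : R) (n : nat) :
  \sum_(0 <= s < n.+1)
     (-1) ^+ s * (\prod_(s <= i < n) (1 - x ^+ i.+1)) *
     x ^+ (s * n + 'C(s.+1, 2)) =
  1 + \sum_(0 <= m < n) (-1) ^+ m.+1 *
        (x ^+ pentagonal_minus m.+1 + x ^+ pentagonal_plus m.+1).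
Proof.
rewrite /pentagonal_minus /pentagonal_plus.
elim: n => [|n IHn].
  by rewrite big_nat1 !big_geq // mul0n add0n bin_small // !mul1r addr0.
rewrite big_nat_recr //= [in RHS]big_nat_recr //= addrA -{}IHn.
rewrite (big_geq (leqnn n.+1)) mulr1.
pose A s := (-1) ^+ s * (\prod_(s <= i < n) (1 - x ^+ i.+1)) *
            x ^+ (s * n + 'C(s.+1, 2)).
pose T s := if s is s'.+1 then A s' * x ^+ (s' + n.+1) else 0.
have T_E s : (s < n.+1)%N -> T s = A s * (x ^+ s - 1).
  case: s => [|s] lesn; first by rewrite subrr mulr0.
  have -> : T s.+1 = (-1) ^+ s * (\prod_(s <= i < n) (1 - x ^+ i.+1)) *
              x ^+ (s.+1 * n + 'C(s.+2, 2)).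
    rewrite /T /A -mulrA -exprD; congr (_ * x ^+ _).
    by rewrite !mulSn [in RHS]binS bin1; lia.
  rewrite /A [in LHS]big_ltn // !(exprS _ s).
  by move: (x ^+ (_ + _)) (\prod_(_ <= _ < _) _) => X P; ring.
have step s : (s < n.+1)%N ->
    (-1) ^+ s * (\prod_(s <= i < n.+1) (1 - x ^+ i.+1)) *
      x ^+ (s * n.+1 + 'C(s.+1, 2)) = A s - (T s.+1 - T s).
  move=> lesn; rewrite (T_E s) // big_nat_recr //=.
  rewrite (_ : s * n.+1 + _ = s * n + 'C(s.+1, 2) + s)%N; last by lia.
  rewrite /T /A !(exprD _ _ s) (exprD _ s n.+1).
  by move: (x ^+ (_ + _)) (x ^+ n.+1) (\prod_(_ <= _ < _) _) => X Y P; ring.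
rewrite (eq_big_nat _ _ (F2 := fun s => A s - (T s.+1 - T s))) //.
rewrite sumrB telescope_sumr // subr0 /= /T {T T_E step} /A.
rewrite (big_geq (leqnn n)) mulr1 -mulrA -exprD -!addrA; congr (_ + _).
rewrite (_ : n * n + _ + _ = n.+1 * n.+1 + 'C(n.+1, 2))%N; last by lia.
by rewrite !exprS; ring.
Qed.

Lemma double_bin2 m : ('C(m, 2) * 2 = m * m.-1)%N.
Proof.
by case: m => // m; rewrite bin2 -[RHS]odd_double_half muln2 oddM /= andNb.
Qed.

Lemma pentagonal_minusE m : ((m * (3 * m - 1)) %/ 2 = pentagonal_minus m)%N.
Proof.
have := double_bin2 m; rewrite /pentagonal_minus; case: m => //= m E.
rewrite -[RHS](mulnK _ (_ : 0 < 2)%N) //; congr (_ %/ _)%N; nia.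
Qed.

Lemma pentagonal_plusE m : ((m * (3 * m + 1)) %/ 2 = pentagonal_plus m)%N.
Proof.
have /= E := double_bin2 m.+1; rewrite /pentagonal_plus.
rewrite -[RHS](mulnK _ (_ : 0 < 2)%N) //; congr (_ %/ _)%N; nia.
Qed.

Lemma pentagonal_minus_lt_plus m :
  (0 < m)%N -> (pentagonal_minus m < pentagonal_plus m)%N.
Proof. by rewrite /pentagonal_minus /pentagonal_plus binS bin1; lia. Qed.

(** Together with [pentagonal_minus_lt_plus], this arranges all generalized
    pentagonal numbers of positive index in one strictly increasing sequence, so
    they are pairwise distinct. *)
Lemma pentagonal_plus_lt_minus a b :
  (a < b)%N -> (pentagonal_plus a < pentagonal_minus b)%N.
Proof.
rewrite /pentagonal_minus /pentagonal_plus.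
by have := double_bin2 a.+1; have := double_bin2 b; case: b => //= b; nia.
Qed.

(** Each [i] is a generalized pentagonal number for at most one index, so the
    choices made in [pentagonal_coef] amount to a sum with at most one nonzero
    term; the bound [n] on the index is harmless because [m] never exceeds the
    m-th pentagonal numbers. *)
Lemma pentagonal_coefE n i : (0 < i <= n)%N ->
  pentagonal_coef i / (i`!)%:R =
    \sum_(0 <= m < n) (-1) ^+ m.+1 *
       ((i == pentagonal_minus m.+1) + (i == pentagonal_plus m.+1))%N%:R.
Proof.
case/andP=> i0 lein.
pose F m : rat :=
  (-1) ^+ m * ((i == pentagonal_minus m) + (i == pentagonal_plus m))%N%:R.
rewrite -/(F _).
have single m : (0 < m <= n)%N ->
    (i == pentagonal_minus m) || (i == pentagonal_plus m) ->
    (-1) ^+ m = \sum_(0 <= m < n) F m.+1.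
  case: m => // m lemn im.
  rewrite big_mkord (bigD1 (Ordinal (lemn : m < n)%N)) //= big1.
    have := @pentagonal_minus_lt_plus m.+1 isT.
    rewrite /F addr0; case/orP: im => /eqP im.
      by do 2![case: eqP]; rewrite ?mulr1 //; lia.
    by do 2![case: eqP]; rewrite ?mulr1 //; lia.
  move=> [m' /= ltm'n]; rewrite -val_eqE /= /F => ne.
  have := @pentagonal_minus_lt_plus m.+1 isT.
  have := @pentagonal_minus_lt_plus m'.+1 isT.
  have [] : (pentagonal_plus m'.+1 < pentagonal_minus m.+1)%N \/
            (pentagonal_plus m.+1 < pentagonal_minus m'.+1)%N.
  - by case: (ltngtP m' m) ne => // lt _; [left|right];
       exact: pentagonal_plus_lt_minus.
  - by do 2![case: eqP]; rewrite ?mulr0 //; lia.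
  - by do 2![case: eqP]; rewrite ?mulr0 //; lia.
rewrite /pentagonal_coef.
case: pickP => [[m /= ltmi] /andP[m0 im]|no_plus].
  rewrite pentagonal_plusE in im.
  by rewrite mulfK ?factq_neq0 // (single m) ?im ?orbT // m0 (leq_trans _ lein).
case: pickP => [[m /= ltmi] /andP[m0 im]|no_minus].
  rewrite pentagonal_minusE in im.
  by rewrite mulfK ?factq_neq0 // (single m) ?im // m0 (leq_trans _ lein).
rewrite mul0r big1 // => m _; rewrite /F.
have [ltmi|leim] := ltnP m i.
  have := no_plus (inord m.+1); have := no_minus (inord m.+1).
  rewrite !inordK // pentagonal_plusE pentagonal_minusE => /= -> ->.
  by rewrite mulr0.
rewrite /pentagonal_minus /pentagonal_plus.
by do 2![case: eqP]; rewrite ?mulr0 //; nia.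
Qed.

(** The exponential generating function [\sum_(1 <= i <= N) x_i X^i / i!];
    its multiple [X] is split off because the powers of [egf x N] are to be
    divided by powers of [X]. *)
Definition egf (x : nat -> rat) (N : nat) : {poly rat} :=
  \poly_(i < N) (x i.+1 / (i.+1)`!%:R) * 'X.

(** In [shanks_identity] at [X], the summand [s = 0] is the Euler product, and
    every other summand is divisible by [X^(n+1)]. *)
Lemma euler_pentagonal n :
  'X^(n.+1) %|
    \prod_(0 <= i < n) (1 - 'X^(i.+1)) - (1 + egf pentagonal_coef n).
Proof.
have := @shanks_identity {poly rat} 'X n.
rewrite big_nat_recl // mul1r add0n bin_small // mulr1.
move/(canRL (addrK _)) => ->; apply/dvdXnP => i lein.
have reorder (a b c : {poly rat}) : 1 + a - b - (1 + c) = a - c - b by ring.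
rewrite reorder !coefB [X in _ - X]coef_sum.
rewrite [X in _ - X]big1 ?subr0 => [|s _]; last first.
  by rewrite coefMXn ifT // binS bin1; nia.
rewrite coef_sum /egf coefMX coef_poly.
rewrite (eq_bigr (fun m => (-1) ^+ m.+1 *
    ((i == pentagonal_minus m.+1) + (i == pentagonal_plus m.+1))%N%:R)).
  case: i lein => [|i] lein /=; last first.
    by rewrite (lein : (i < n)%N) -pentagonal_coefE // subrr.
  by rewrite subr0 big1 // => m _; rewrite mulr0.
by move=> m _; rewrite coef_signM coefD !coefXn natrD.
Qed.

(** * Partial Bell polynomials *)

(** Multinomial theorem, divided by [l!].  With a marker variable [T], the
    truncated exponentials [E z = \sum_(j <= N) z^j T^j / j!] satisfy
    [E y * E z = E (y + z)] up to degree [N] in [T], by the binomial theorem.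
    Comparing the coefficients of [T^l] in [\prod_i E (y_i)] and in
    [E (\sum_i y_i)] gives the formula. *)
Lemma multinomial_theorem (A : comAlgType rat) (I : finType) (y : I -> A)
    (N l : nat) :
  (l <= N)%N ->
  \sum_(e : {ffun I -> 'I_N.+1} | (\sum_i e i == l)%N)
    (\prod_i (e i)`!)%:R^-1 *: \prod_i y i ^+ e i =
  (l`!)%:R^-1 *: (\sum_i y i) ^+ l.
Proof.
move=> lelN.
pose E z : {poly A} := \sum_(j < N.+1) ((j`!)%:R^-1 *: z ^+ j)%:P * 'X^j.
have E_coef z j : (j <= N)%N -> (E z)`_j = (j`!)%:R^-1 *: z ^+ j.
  move=> lejN; rewrite /E coef_sum (bigD1 (inord j)) //= inordK //.
  rewrite coefCM coefXn eqxx mulr1 big1 ?addr0 // => i ne_ij.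
  rewrite coefCM coefXn (_ : j == i = false) ?mulr0 //.
  by apply: contraNF ne_ij => /eqP ->; rewrite inord_val.
have prodE : forall j, (j <= N)%N ->
    (\prod_i E (y i))`_j = (j`!)%:R^-1 *: (\sum_i y i) ^+ j.
  apply: (big_rec2 (fun (p : {poly A}) z => forall j, (j <= N)%N ->
            p`_j = (j`!)%:R^-1 *: z ^+ j)).
    by case=> [|j] _; rewrite coef1 ?expr0n /= ?invr1 ?scale1r ?scaler0.
  move=> i p z _ IH j lejN; rewrite coefM addrC exprDn scaler_sumr.
  apply: eq_bigr => [[m /= ltmj] _].
  rewrite E_coef; last by lia.
  rewrite IH; last by lia.
  rewrite -scalerAl -scalerAr scalerA mulrC -[in RHS]scaler_nat scalerA.
  congr (_ *: _); last by rewrite mulrC.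
  rewrite -(bin_fact (ltmj : m <= j)%N) !natrM.
  have := factq_neq0 m; have := factq_neq0 (j - m).
  have : ('C(j, m))%:R != 0 :> rat by rewrite pnatr_eq0 -lt0n bin_gt0.
  by move=> h1 h2 h3; field; rewrite h1 h2 h3.
rewrite -prodE // /E bigA_distr_bigA coef_sum.
rewrite [RHS]big_mkcond [LHS]big_mkcond /=.
apply: eq_bigr => e _; rewrite big_split /= -rmorph_prod coefCM.
rewrite -expr_sum coefXn eq_sym; case: eqP => _; last by rewrite mulr0.
by rewrite mulr1 scaler_prod natr_prod -prodfV.
Qed.

Lemma egf_expE x N :
  egf x N = \sum_(i < N) (x i.+1 / (i.+1)`!%:R) *: 'X^(i.+1).
Proof.
rewrite /egf poly_def big_distrl /=; apply: eq_bigr => i _.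
by rewrite -scalerAl -exprSr.
Qed.

(** A monomial of degree [n] in the l-th power of a series without constant term
    involves only the variables of index at most [n - l + 1], since the other
    [l - 1] factors have degree at least 1.  This is why the Bell polynomial
    stops at that variable. *)
Lemma coef_egf_exp x l n N :
  (n < N + l)%N -> (egf x N ^+ l)`_n = (egf x n ^+ l)`_n.
Proof.
case: l => [|l] ltn; first by rewrite !expr0.
rewrite /egf !exprMn !coefMXn; case: ltnP => // leln.
set p := \poly_(i < N) _; set q := \poly_(i < n) _.
apply/eqP; rewrite -subr_eq0 -coefB.
suff /dvdXnP -> : 'X^((n - l.+1).+1) %| p ^+ l.+1 - q ^+ l.+1 => //.
rewrite subrXX dvdp_mulr //; apply/dvdXnP => i lti.
by rewrite coefB !coef_poly !ifT ?subrr //; lia.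
Qed.

Lemma partial_bellE (n l : nat) (x : nat -> rat) : (l <= n)%N ->
  partial_bell n l x = (n`!)%:R / (l`!)%:R * (egf x n ^+ l)`_n.
Proof.
move=> leln; rewrite -(@coef_egf_exp _ _ _ (n - l + 1)); last by lia.
rewrite egf_expE -mulrA -coefZ -(multinomial_theorem _ leln) coef_sum.
rewrite big_distrr /= [RHS]big_mkcond [LHS]big_mkcond /=.
apply: eq_bigr => e _; rewrite andbC; case: eqP => //= _.
rewrite coefZ [in RHS](eq_bigr (fun i : 'I_(n - l + 1) =>
  (x i.+1 / (i.+1)`!%:R) ^+ e i *: 'X^(i.+1 * e i))); last first.
  by move=> i _; rewrite exprZn -exprM.
rewrite scaler_prod coefZ -expr_sum coefXn eq_sym.
by case: eqP => _; rewrite ?mulr1 ?mulr0 // mulrA.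
Qed.

(** * The binomial series with negative integer exponent *)

Lemma rising_factorial0 l : rising_factorial 0 l = (l == 0)%N.
Proof.
by case: l => [|l]; rewrite /rising_factorial ?big_ord0 // big_ord_recl mul0n.
Qed.

Lemma rising_factorialSl k l :
  rising_factorial k l.+1 = (k * rising_factorial k.+1 l)%N.
Proof.
rewrite /rising_factorial big_ord_recl addn0; congr (_ * _)%N.
by apply: eq_bigr => i _; rewrite addSnnS.
Qed.

Lemma rising_factorialSr k l :
  rising_factorial k l.+1 = (rising_factorial k l * (k + l))%N.
Proof. by rewrite /rising_factorial big_ord_recr. Qed.

Definition binomial_series (R : comAlgType rat) (k N : nat) (u : R) : R :=
  \sum_(0 <= l < N)
    ((-1) ^+ l * (rising_factorial k l)%:R / (l`!)%:R) *: u ^+ l.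

(** Pascal's rule: the coefficients are [(-1)^l 'C(k + l - 1, l)], so multiplying
    by [1 + u] lowers [k] by one, except for the term cut off at [u^N]. *)
Lemma binomial_seriesS (R : comAlgType rat) k N (u : R) :
  exists q, (1 + u) * binomial_series k.+1 N u =
            binomial_series k N u + q * u ^+ N.
Proof.
rewrite /binomial_series; case: N => [|N].
  by exists 0; rewrite !big_geq // mul0r mulr0 addr0.
pose a j l : rat := (-1) ^+ l * (rising_factorial j l)%:R / (l`!)%:R.
have aS l : a k.+1 l.+1 + a k.+1 l = a k l.+1.
  rewrite /a rising_factorialSr (rising_factorialSl k) factS !natrM !natrD.
  have l0 : 1 + l%:R != 0 :> rat by rewrite nat1r pnatr_eq0.
  by have lf0 := factq_neq0 l; rewrite exprS; field; rewrite lf0 l0.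
exists (a k.+1 N)%:A; rewrite -!/(a _ _).
rewrite mulrDl mul1r {1}big_nat_recl // [in X in _ + X = _]big_nat_recr //=.
rewrite [in RHS]big_nat_recl //= mulrDr big_distrr /=.
rewrite -!addrA; congr (_ + _); first by rewrite /rising_factorial !big_ord0.
rewrite addrA -big_split /=; congr (_ + _).
  apply: eq_bigr => l _; rewrite -!/(a _ _) -aS scalerDl; congr (_ + _).
  by rewrite -scalerAr -exprS.
by rewrite -scalerAr -exprS -scalerAl mul1r.
Qed.

Lemma binomial_series_inverse (R : comAlgType rat) k N (u : R) :
  (0 < N)%N ->
  exists q, (1 + u) ^+ k * binomial_series k N u = 1 + q * u ^+ N.
Proof.
move=> N0; elim: k => [|k [q IHk]].
  exists 0; rewrite mul0r addr0 mul1r /binomial_series big_ltn // big_nat big1.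
    by rewrite rising_factorial0 !expr0 fact0 !mul1r eqxx scale1r addr0.
  move=> l /andP[l0 _].
  by rewrite rising_factorial0 eqn0Ngt l0 mulr0 mul0r scale0r.
have [q' E] := binomial_seriesS k N u; exists (q + (1 + u) ^+ k * q').
rewrite exprSr -mulrA E mulrDr IHk mulrDl addrA; congr (_ + _); exact: mulrA.
Qed.

(** * Counting coloured partitions *)

Section Counting.
Local Open Scope mset_scope.
Local Open Scope fset_scope.
Local Open Scope nat_scope.

(** A coloured partition of [n] has parts in [1, n] and multiplicities at most
    [n], so it is encoded by a finite function; index [i] stands for part
    [i + 1]. *)
Definition coloured_part k n (x : 'I_n * 'I_k) : nat * 'I_k := (x.1.+1, x.2).

Definition mset_of_multiplicities k n (e : {ffun 'I_n * 'I_k -> 'I_n.+1}) :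
    {mset nat * 'I_k} :=
  seq_mset (flatten [seq nseq (e x) (coloured_part x) | x <- index_enum _]).

Lemma coloured_part_inj k n : injective (@coloured_part k n).
Proof. by move=> [i c] [j d] [/ord_inj -> ->]. Qed.

Lemma mset_of_multiplicitiesE k n (e : {ffun 'I_n * 'I_k -> 'I_n.+1})
    (y : nat * 'I_k) :
  mset_of_multiplicities e y = \sum_(x | coloured_part x == y) e x.
Proof.
rewrite mset_seqE count_flatten sumnE !big_map [RHS]big_mkcond /=.
by apply: eq_bigr => x _; rewrite count_nseq /=; case: eqP; rewrite ?mul1n.
Qed.

Lemma mset_of_multiplicities_part k n (e : {ffun 'I_n * 'I_k -> 'I_n.+1}) x :
  mset_of_multiplicities e (coloured_part x) = e x.
Proof.
by rewrite mset_of_multiplicitiesE (big_pred1 x) // => z;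
  rewrite (inj_eq (@coloured_part_inj k n)).
Qed.

Lemma mset_of_multiplicities_weight k n (e : {ffun 'I_n * 'I_k -> 'I_n.+1}) :
  \sum_(y <- mset_of_multiplicities e) y.1 =
  \sum_(x : 'I_n * 'I_k) x.1.+1 * e x.
Proof.
rewrite (perm_big _ (perm_eq_seq_mset _)) big_flatten big_map /=.
by apply: eq_bigr => x _; rewrite big_nseq iter_addn_0.
Qed.

Lemma coloured_partitionP k n (A : {mset nat * 'I_k}) :
  reflect (exists2 e : {ffun 'I_n * 'I_k -> 'I_n.+1},
             \sum_(x : 'I_n * 'I_k) x.1.+1 * e x = n &
             A = mset_of_multiplicities e)
          (coloured_partition n A).
Proof.
apply: (iffP andP) => [[/allP A0 /eqP wA]|[e we ->]]; last first.
  rewrite mset_of_multiplicities_weight we eqxx; split=> //; apply/allP => y.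
  rewrite (perm_mem (perm_eq_seq_mset _)) => /flattenP[s /mapP[x _ ->]].
  by case/nseqP => ->.
have weight_le y : A y * y.1 <= n.
  case: (boolP (y \in A)) => [yA|/mset_eq0P ->] //.
  rewrite -wA sum_mset (bigD1_seq y) /= ?msuppE ?fset_uniq //.
  exact: leq_addr.
pose e : {ffun 'I_n * 'I_k -> 'I_n.+1} :=
  [ffun x => inord (A (coloured_part x))].
have eA : A = mset_of_multiplicities e.
  apply/msetP => y; rewrite mset_of_multiplicitiesE.
  case: (boolP (y \in A)) => [yA|nyA].
    have y0 := A0 _ yA; have := weight_le y.
    have : 0 < A y by rewrite -in_mset.
    case: y {yA} y0 => [[|i] c] //= _ Ay0 Ay.
    have lti : i < n by apply: leq_trans Ay; rewrite leq_pmull.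
    rewrite (big_pred1 (Ordinal lti, c)); last first.
      by move=> x; rewrite /= -(inj_eq (@coloured_part_inj k n)).
    rewrite ffunE inordK //= ltnS; apply: leq_trans Ay.
    by rewrite leq_pmulr.
  rewrite (mset_eq0P nyA) big1 // => x /eqP partx.
  by rewrite ffunE partx (mset_eq0P nyA) inordK.
by exists e => //; rewrite -mset_of_multiplicities_weight -eA wA.
Qed.

Lemma ncoloured_partitionsE k n :
  ncoloured_partitions k n =
    #|[pred e : {ffun 'I_n * 'I_k -> 'I_n.+1} |
        \sum_(x : 'I_n * 'I_k) x.1.+1 * e x == n]|.
Proof.
set P := [pred e | _].
have -> : #|P| = #|` [fset mset_of_multiplicities e | e in P]|.
  rewrite card_imfset ?cardE //= => e1 e2 eq12.
  apply/ffunP => x; apply: ord_inj.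
  by rewrite -!mset_of_multiplicities_part eq12.
rewrite /ncoloured_partitions; congr (#|` _|); apply/fsetP => A.
rewrite in_fset_set; last exact: finite_coloured_partitions.
apply/idP/imfsetP => [/set_mem/coloured_partitionP[e we ->]|[e]] /=.
  by exists e; rewrite // inE we.
by rewrite !inE => /eqP we ->; apply/coloured_partitionP; exists e.
Qed.

End Counting.

(** [G] is the product, over all parts [i <= n] and all colours, of the geometric
    series [1 + X^i + ... + X^(i n)].  Expanding it enumerates the multiplicity
    functions, and multiplying each series by [1 - X^i] leaves
    [1 - X^(i (n + 1))]. *)
Lemma coloured_generating k n :
  exists2 G : {poly rat},
    (ncoloured_partitions k n)%:R = G`_n &
    'X^(n.+1) %| (\prod_(0 <= i < n) (1 - 'X^(i.+1))) ^+ k * G - 1.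
Proof.
exists (\prod_(x : 'I_n * 'I_k) \sum_(j < n.+1) 'X^(x.1.+1 * j)%N).
  rewrite bigA_distr_bigA coef_sum ncoloured_partitionsE -sum1_card natr_sum.
  rewrite big_mkcond; apply: eq_bigr => e _ /=.
  by rewrite -expr_sum coefXn inE eq_sym; case: eqP.
rewrite -prodrXl big_mkord.
rewrite (eq_bigr (fun i : 'I_n => \prod_(c < k) (1 - 'X^(i.+1)))); last first.
  by move=> i _; rewrite prodr_const card_ord.
rewrite pair_big -big_split /=.
apply: (big_ind (fun p : {poly rat} => 'X^(n.+1) %| p - 1)).
- by rewrite subrr dvdp0.
- move=> p q p1 q1.
  rewrite (_ : p * q - 1 = (p - 1) * q + (q - 1)); last by ring.
  by rewrite dvdp_add // dvdp_mulr.
case=> i c _ /=.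
under eq_bigr => j _ do rewrite exprM.
rewrite -[1 - 'X^_]opprB mulNr -subrX1 opprB addrAC subrr sub0r dvdpNr -exprM.
by rewrite dvdp_exp2l // mulSn leq_addr.
Qed.

Theorem theorem1 (n k : nat) (hn : (0 < n)%N) (hk : (0 < k)%N) :
  (ncoloured_partitions k n)%:R =
    (n`!)%:R^-1 *
      \sum_(0 <= l < n.+1)
        (-1) ^+ l * (rising_factorial k l)%:R *
          partial_bell n l pentagonal_coef :> rat.
Proof.
have [G -> QG] := coloured_generating k n.
set Q := \prod_(0 <= i < n) _ in QG.
set u := egf pentagonal_coef n.
have [q uF] := @binomial_series_inverse {poly rat} k n.+1 u isT.
set F := binomial_series k n.+1 u in uF.
have GF : 'X^(n.+1) %| G - F.
  (* Uniqueness of the inverse: modulo X^(n+1), G = G (1 + u)^k F = G Q^k F = F. *)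
  have -> : G - F = - (((1 + u) ^+ k * F - 1) * G) -
      (Q ^+ k - (1 + u) ^+ k) * (F * G) + (Q ^+ k * G - 1) * F by ring.
  rewrite dvdp_add ?dvdp_sub ?dvdpNr ?dvdp_mulr //.
    by rewrite uF addrAC subrr add0r dvdp_mull // /u /egf exprMn dvdp_mull.
  by rewrite subrXX dvdp_mulr // euler_pentagonal.
have /eqP -> : G`_n == F`_n by rewrite -subr_eq0 -coefB (dvdXnP _ _ GF).
rewrite /F /binomial_series coef_sum big_distrr /= !big_mkord.
apply: eq_bigr => l _.
rewrite coefZ partial_bellE -1?ltnS //.
have := factq_neq0 n; have := factq_neq0 l => l0 n0.
by field; rewrite l0 n0.
Qed.
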